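(* For all integers $\mu,\nu,N\ge0$, $$A(\mu,\nu,N)=B(\mu,\nu,N).$$
   Context: $A(\mu,\nu,N)$ denotes the number of partitions of $N$ into distinct parts that are not multiples of $3$, of which exactly $\mu$ parts are congruent to $1$ or $2$ mod $6$ and exactly $\nu$ parts are congruent to $4$ or $5$ mod $6$. Equivalently, $$\sum_{\mu,\nu,N\ge0}A(\mu,\nu,N)a^\mu b^\nu q^N=\prod_{n=0}^\infty(1+aq^{6n+1})(1+aq^{6n+2})(1+bq^{6n+4})(1+bq^{6n+5}).$$ $B(\mu,\nu,N)$ denotes the number of partitions $b_1+\cdots+b_s$ of $N$ (positive integer parts, $b_1\ge b_2\ge\cdots\ge b_s$; the empty partition is the only partition of $0$) satisfying the following conditions, where $f_i$ denotes the number of appearances of $i$ as a part: (i) Only multiples of $6$ may be repeated. (ii) $b_i-b_{i+2}\ge6$ for $1\le i\le s-2$, with strict inequality if $b_i$ is a multiple of $6$. (iii) $f_{6j+3}=0$ for all $j\ge0$; $f_{6j+2}+f_{6j+4}\le1$ for all $j\ge0$; $f_{6j+5}+f_{6j+7}\le1$ for all $j\ge0$; $f_{6j-1}+f_{6j}+f_{6j+6}+f_{6j+7}\le3$ for all $j\ge1$. (iv) Exactly $\mu$ parts (counted with multiplicity) are $\equiv0$, $1$ or $2\pmod6$. (v) Exactly $\nu$ parts (counted with multiplicity) are $\equiv0$, $4$ or $5\pmod6$. *)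

(* Defs.v *)
From mathcomp Require Import all_boot zify.

Set Implicit Arguments.
Unset Strict Implicit.
Unset Printing Implicit Defensive.

Definition is_partition (N : nat) (s : seq nat) : bool :=
  [&& sorted geq s, all (leq 1) s & sumn s == N].

(* A partition of N has at most N parts, each of them at most N (see
   [is_partition_bounded]), so the finite type [N.-bseq 'I_N.+1] of sequences
   of length at most N over {0, ..., N} contains all the partitions of N. *)
Definition num_partitions (N : nat) (P : pred (seq nat)) : nat :=
  #|[set s : N.-bseq 'I_N.+1 |
      is_partition N (map val s) && P (map val s)]|.

Definition parts_mod6 (R : seq nat) (s : seq nat) : nat :=
  count (fun x => x %% 6 \in R) s.

Definition A (mu nu N : nat) : nat :=
  num_partitions N (fun s =>
    [&& uniq s,
        all (fun x => ~~ (3 %| x)) s,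
        parts_mod6 [:: 1; 2] s == mu &
        parts_mod6 [:: 4; 5] s == nu]).

Definition repeat_cond (s : seq nat) : bool :=
  all (fun i => (6 %| i) || (count_mem i s <= 1)) s.

(* Positions are numbered from 0, so [i] and [i.+2] are both positions of [s]
   exactly when [i < size s - 2]. *)
Definition gap_cond (s : seq nat) : bool :=
  all (fun i => let d := nth 0 s i - nth 0 s i.+2 in
                (6 <= d) && ((6 %| nth 0 s i) ==> (6 < d)))
      (iota 0 (size s - 2)).

Definition freq_cond_at (s : seq nat) (j : nat) : bool :=
  let f i := count_mem i s in
  [&& f (6 * j + 3) == 0,
      f (6 * j + 2) + f (6 * j + 4) <= 1,
      f (6 * j + 5) + f (6 * j + 7) <= 1 &
      (1 <= j) ==>
        (f (6 * j - 1) + f (6 * j) + f (6 * j + 6) + f (6 * j + 7) <= 3)].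

(* The bound on [j] is harmless: [freq_condP] shows that this is the condition
   [freq_cond_at s j] for every natural number [j]. *)
Definition freq_cond (s : seq nat) : bool :=
  all (freq_cond_at s) (iota 0 (sumn s).+1).

Definition B (mu nu N : nat) : nat :=
  num_partitions N (fun s =>
    [&& repeat_cond s,
        gap_cond s,
        freq_cond s,
        parts_mod6 [:: 0; 1; 2] s == mu &
        parts_mod6 [:: 0; 4; 5] s == nu]).

Lemma mem_leq_sumn (s : seq nat) (x : nat) : x \in s -> x <= sumn s.
Proof.
elim: s => //= y s IH; rewrite inE => /orP[/eqP -> | /IH]; first exact: leq_addr.
by move=> h; apply: leq_trans h (leq_addl _ _).
Qed.

Lemma is_partition_bounded (N : nat) (s : seq nat) :
  is_partition N s -> size s <= N /\ all (fun x => x <= N) s.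
Proof.
case/and3P=> _ pos /eqP <-; split.
  elim: s pos => //= x s IH /andP[x1 /IH h]; lia.
by apply/allP => x; apply: mem_leq_sumn.
Qed.

Lemma num_partitionsP (N : nat) (P : pred (seq nat)) (l : seq (seq nat)) :
  uniq l -> (forall s, (s \in l) = is_partition N s && P s) ->
  num_partitions N P = size l.
Proof.
move=> ul lP; rewrite /num_partitions cardE.
pose g (s : N.-bseq 'I_N.+1) := [seq val x | x <- s].
have g_inj : injective g.
  by move=> s t /(inj_map val_inj) st; apply: val_inj.
rewrite -(size_map g); apply/perm_size/uniq_perm => //.
  by rewrite map_inj_uniq ?enum_uniq.
move=> s; apply/mapP/idP => [[t]|].
  by rewrite mem_enum inE -lP => tl ->.
rewrite lP => Ps; have /andP[/is_partition_bounded[sN /allP leN] _] := Ps.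
have sN' : size (map (@inord N) s) <= N by rewrite size_map.
have gE : s = g (Bseq sN').
  rewrite /g /= -map_comp -[LHS]map_id; apply/eq_in_map => x xs /=.
  by rewrite inordK // ltnS leN.
by exists (Bseq sN') => //; rewrite mem_enum inE -/(g _) -gE.
Qed.

Lemma freq_condP (s : seq nat) :
  reflect (forall j, freq_cond_at s j) (freq_cond s).
Proof.
apply: (iffP allP) => [h j | h j _]; last exact: h.
have [jN | Nj] := leqP j (sumn s); first by apply: h; rewrite mem_iota.
have f0 i : sumn s < i -> count_mem i s = 0.
  move=> si; apply/count_memPn; apply/negP => /mem_leq_sumn; lia.
by rewrite /freq_cond_at !f0 ?implybT //; lia.
Qed.

(* Main.v *)
Require Import Defs.
From mathcomp Require Import all_boot all_algebra zify ring.

Set Implicit Arguments.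
Unset Strict Implicit.
Unset Printing Implicit Defensive.

Import GRing.Theory.

(** Both sides are compared through the polynomials in [a], [b], [q] that
    enumerate the partitions with parts at most [6 * n]; a multiple of [6]
    counts for both [a] and [b], so with
      [a1 = a q], [a2 = a q^2], [b1 = b q^4], [b2 = b q^5], [c = a b q^6]
    the parts [6 m + 1], [6 m + 2], [6 m + 4], [6 m + 5], [6 m + 6] have the
    weights [a1], [a2], [b1], [b2], [c] times [Q^m], where [Q = q^6].  The
    proof rests on the relation [c = a1 b2 = a2 b1].

    The conditions on the second kind of partitions are local: whether a part
    may be put in front of a partition is a matter of the parts at distance at
    most [8] ([admissibleE]).  Hence such a partition is built block after
    block, a block being its parts in [6 m + 1 .. 6 m + 6], by an automaton
    with nine states ([windows_closed]).  The weighted sums over the moves from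
    these nine states span a space of dimension four ([moves_sum_columns]), so
    that the enumerating polynomials obey a linear recurrence in [n] on four
    quantities.  In suitable coordinates ([transfer], [gfB_transfer]) its
    coefficients depend on [a] and [b] only through the symmetric quantities
    [a1 + a2 + b1 + b2], [(a1 + b2) (a2 + b1)] and [c].

    Let [T_n (a, b)] and [U_n (a, b)] enumerate the partitions with parts at
    most [6 n] and those with parts less than [6 n].  The key identity is
      [T_(n+1) (a, b) =
         (1 + a1) (1 + a2) (1 + b1) (1 + b2) U_n (a Q, b Q)],
    proved in [total_transfer_shift] by a linear map that intertwines the
    recurrence with the one for the parameters [a Q], [b Q].  (It is not a mere
    shift of all the parts by [6], because [a Q] and [b Q] turn [c] into
    [c Q^2].)  As [T_n] and [U_n] agree up to multiples of [q^(6 n)], iterating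
    the identity shows that [T_n] agrees with the product of the
      [(1 + a1 Q^i) (1 + a2 Q^i) (1 + b1 Q^i) (1 + b2 Q^i)], [i < n],
    up to high powers of [q] ([total_product]).  This product enumerates the
    partitions of the first kind ([gfA_product]), and the theorem is the
    equality of the coefficients. *)

(** * The conditions as a test on each new largest part *)

Definition count_diffs (x : nat) (ds : seq nat) (t : seq nat) : nat :=
  count (fun y => has (fun d => y + d == x) ds) t.

(** For a part [x] with [x %% 6 = r] in front of a partition [t], the pair
    [(ds, k)] demands that at most [k] parts of [t] differ from [x] by an
    element of [ds].  The set [[:: 0]] forbids a repetition; the initial
    segments of [nat] express the condition on parts two places apart; [[:: 2]]
    comes from the pairs [(6 j + 2, 6 j + 4)] and [(6 j + 5, 6 j + 7)]; and
    [[:: 1; 7; 8]] from the condition on four frequencies, with [x = 6 j + 7].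
    For the other values of [x] in that condition the bound [3] follows from
    the rest. *)
Definition diff_bounds (r : nat) : seq (seq nat * nat) :=
  match r with
  | 0 => [:: (iota 0 7, 1)]
  | 1 => [:: ([:: 0], 0); (iota 0 6, 1); ([:: 2], 0); ([:: 1; 7; 8], 2)]
  | 4 => [:: ([:: 0], 0); (iota 0 6, 1); ([:: 2], 0)]
  | _ => [:: ([:: 0], 0); (iota 0 6, 1)]
  end.

Definition fits (x : nat) (t : seq nat) : bool :=
  (x %% 6 != 3) &&
  all (fun r => count_diffs x r.1 t <= r.2) (diff_bounds (x %% 6)).

Fixpoint admissible (t : seq nat) : bool :=
  if t is x :: t' then fits x t' && admissible t' else true.

Lemma count_diffs_sum x ds t : uniq ds ->
  count_diffs x ds t = sumn [seq count (fun y => y + d == x) t | d <- ds].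
Proof.
elim: ds => /= [_|d ds IH /andP[dds uds]]; first by elim: t.
rewrite -IH // /count_diffs -count_predUI [X in _ + X](_ : _ = 0) ?addn0.
  by apply: eq_count => y /=.
rewrite (eq_count (a2 := pred0)) ?count_pred0 // => y /=.
apply/negP => /andP[/eqP yd /hasP[d' dd' /eqP yd']].
by case/negP: dds; rewrite (_ : d = d') //; lia.
Qed.

Lemma repeat_cond_cons x t :
  repeat_cond (x :: t) =
  ((6 %| x) || (count_diffs x [:: 0] t <= 0)) && repeat_cond t.
Proof.
have -> : count_diffs x [:: 0] t = count_mem x t.
  by apply: eq_count => y /=; rewrite addn0 orbF.
rewrite /repeat_cond /= eqxx add1n ltnS leqn0.
have [x6|x6] /= := boolP (6 %| x).
  apply: eq_all => i /=; case: (eqVneq x i) => [<-|]; by rewrite ?x6.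
have [f0|//] /= := eqVneq (count_mem x t) 0.
apply: eq_in_all => i it /=; case: eqVneq => [xi|//].
by move/count_memPn: f0; rewrite xi it.
Qed.

(** In a nonincreasing list a window of values just below [x] contains at most
    one entry of [t] exactly when the second entry of [t] lies outside it. *)
Lemma gap_cond_cons x t : sorted geq (x :: t) ->
  gap_cond (x :: t) =
  (count_diffs x (iota 0 (6 + (6 %| x))) t <= 1) && gap_cond t.
Proof.
rewrite /gap_cond /= => xt.
have P y : y \in t -> y <= x.
  move: xt; rewrite (path_sortedE (rev_trans leq_trans)).
  by move=> /andP[/allP h _] /h.
have -> : count_diffs x (iota 0 (6 + (6 %| x))) t =
    count (fun y => x < y + 6 + (6 %| x)) t.
  apply: eq_in_count => y /P yx; apply/hasP/idP => [[d]|h].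
    by rewrite mem_iota => ? /eqP; lia.
  by exists (x - y); rewrite ?mem_iota; lia.
case: t xt P => [//|y [|z t]] xt P; first by rewrite /= !addn0; lia.
rewrite (_ : (size _).+1 - 2 = (size t).+1); last by rewrite /=; lia.
rewrite [iota 0 _.+1]/= -[1]/(1 + 0) iotaDl /= all_map.
rewrite (_ : (size _).+2 - 2 = (size t)); last by rewrite /=; lia.
congr (_ && _).
move: xt => /= /and3P[xy yz zt].
have -> : (x < y + 6 + (6 %| x)) + ((x < z + 6 + (6 %| x)) +
    count (fun i => x < i + 6 + (6 %| x)) t) <= 1 = ~~ (x < z + 6 + (6 %| x)).
  have [h|h] /= := boolP (x < z + 6 + _).
    have -> : x < y + 6 + (6 %| x) by move: yz; rewrite /geq /=; lia.
    by rewrite -ltnS; lia.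
  rewrite (eq_in_count (a2 := pred0)) ?count_pred0 ?addn0; first by lia.
  move=> i it /=; apply/negP.
  move: zt; rewrite (path_sortedE (rev_trans leq_trans)).
  by move=> /andP[/allP /(_ _ it)] /=; lia.
case: (6 %| x) => /=; lia.
Qed.

(** Adding [x] changes the frequency conditions only in those [j] for which [x]
    is one of the indices involved.  The larger indices then have frequency [0],
    and the conditions on repetitions and on parts two places apart bound the
    smaller ones, except in the three cases that remain as explicit tests. *)
Lemma freq_cond_cons x t :
  sorted geq (x :: t) -> all (leq 1) (x :: t) -> repeat_cond (x :: t) ->
  count_diffs x (iota 0 (6 + (6 %| x))) t <= 1 ->
  freq_cond (x :: t) =
  [&& x %% 6 != 3,
      (x %% 6 \in [:: 1; 4]) ==> (count_diffs x [:: 2] t <= 0),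
      (x %% 6 == 1) ==> (count_diffs x [:: 1; 7; 8] t <= 2) & freq_cond t].
Proof.
move=> xt pos; rewrite repeat_cond_cons => /andP[rx rt] gx.
pose f i := count_mem i t.
have f_gt i : x < i -> f i = 0.
  move=> xi; apply/count_memPn; apply/negP => it; move: xt => /=.
  rewrite (path_sortedE (rev_trans leq_trans)).
  by move=> /andP[/allP /(_ _ it)] /=; lia.
have f0 : f 0 = 0.
  by apply/count_memPn/negP => it; move: pos => /= /andP[_ /allP /(_ _ it)].
have f1 i : i %% 6 != 0 -> f i <= 1.
  move=> i6; have [it|/count_memPn] := boolP (i \in t); last first.
    by rewrite /f => ->.
  by move/allP: rt => /(_ _ it) /orP[|//]; lia.
have fE d : d <= x -> count (fun y => y + d == x) t = f (x - d).
  by move=> dx; apply: eq_count => y /=; apply/eqP/eqP; lia.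
have gE d : x <= d -> count (fun y => y + d == x) t = 0.
  rewrite leq_eqVlt => /orP[/eqP <-|xd]; first by rewrite fE // subnn.
  by rewrite (eq_count (a2 := pred0)) ?count_pred0 // => y /=; lia.
pose f' i := (x == i) + f i.
have at_cons j : freq_cond_at (x :: t) j =
  [&& f' (6 * j + 3) == 0,
      f' (6 * j + 2) + f' (6 * j + 4) <= 1,
      f' (6 * j + 5) + f' (6 * j + 7) <= 1 &
      (1 <= j) ==>
        (f' (6 * j - 1) + f' (6 * j) + f' (6 * j + 6) + f' (6 * j + 7) <= 3)].
  by [].
rewrite /f' {f'} in at_cons.
have at_t j : freq_cond_at t j =
  [&& f (6 * j + 3) == 0,
      f (6 * j + 2) + f (6 * j + 4) <= 1,
      f (6 * j + 5) + f (6 * j + 7) <= 1 &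
      (1 <= j) ==>
        (f (6 * j - 1) + f (6 * j) + f (6 * j + 6) + f (6 * j + 7) <= 3)] by [].
have rx' : 6 %| x \/ f x = 0.
  case/orP: rx => [|]; first by left.
  by rewrite count_diffs_sum //= addn0 fE // subn0; right; lia.
rewrite !count_diffs_sum //= !addn0 leqn0.
have {}gx d e : d < e < 6 + (6 %| x) -> e <= x -> f (x - d) + f (x - e) <= 1.
  move=> /andP[de e6] ex; rewrite -!fE //; try lia.
  apply: leq_trans gx; rewrite /count_diffs -count_predUI.
  rewrite (eq_count (a2 := fun y => (y + d == x) || (y + e == x))) //.
  rewrite [X in _ + X](_ : _ = 0) ?addn0.
    apply: sub_count => y H; apply/hasP.
    by case/orP: H => yx; [exists d|exists e] => //; rewrite mem_iota; lia.
  by rewrite (eq_count (a2 := pred0)) ?count_pred0 // => y /=; lia.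
clearbody f.
apply/(freq_condP (x :: t))/and4P => [H|[x3 h2 h178 /freq_condP H] j].
  split; last first.
  - apply/freq_condP => j; move: (H j); rewrite at_cons at_t.
    clear; move=> /and4P[c1 c2 c3 c4]; apply/and4P; split; [lia|lia|lia|].
    apply/implyP => j1; move/implyP: c4 => /(_ j1); clear; lia.
  - apply/implyP => x1; have [x7|x7] := leqP x 7.
      have x7' : x = 7 \/ x = 1 by lia.
      rewrite (gE 7) ?(gE 8); try lia.
      case: x7' => E; subst x; last by rewrite gE.
      by rewrite fE //; have /= := gx 1 2 isT isT; lia.
    have := H (x %/ 6).-1; rewrite at_cons !fE; try lia.
    rewrite (_ : x - 1 = 6 * (x %/ 6).-1 + 6); last lia.
    rewrite (_ : x - 7 = 6 * (x %/ 6).-1); last lia.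
    rewrite (_ : x - 8 = 6 * (x %/ 6).-1 - 1); last lia.
    move=> /and4P[_ _ _]; have -> : 1 <= (x %/ 6).-1 by lia.
    rewrite implyTb; lia.
  - apply/implyP; rewrite !inE => /orP[] /eqP x1.
      have [x2|x2] := leqP x 2; first by rewrite gE.
      rewrite fE; last lia.
      have := H (x %/ 6).-1; rewrite at_cons => /and4P[_ _ h _].
      rewrite (_ : x - 2 = 6 * (x %/ 6).-1 + 5); lia.
    rewrite fE; last lia.
    have := H (x %/ 6); rewrite at_cons => /and4P[_ h _ _].
    rewrite (_ : x - 2 = 6 * (x %/ 6) + 2); lia.
  - have := H (x %/ 6); rewrite at_cons => /and4P[h _ _ _]; lia.
have := H j; rewrite at_cons at_t => /and4P[/eqP A1 A2 A3 A4].
have g4 := f_gt (6 * j + 4); have g7 := f_gt (6 * j + 7).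
have g6 := f_gt (6 * j + 6); have g0 := f_gt (6 * j).
apply/and4P; split.
- lia.
- case: (eqVneq x (6 * j + 2)) => [E|n2].
    have f2 : f (6 * j + 2) = 0 by rewrite -E; case: rx' => [h|->]; [lia|].
    by rewrite f2 g4; lia.
  case: (eqVneq x (6 * j + 4)) => [E|n4]; last by lia.
  have f4 : f (6 * j + 4) = 0 by rewrite -E; case: rx' => [h|->]; [lia|].
  have := implyP h2; rewrite (_ : x %% 6 = 4); last lia.
  rewrite !inE => /(_ isT); rewrite fE; last lia.
  by rewrite (_ : x - 2 = 6 * j + 2); lia.
- case: (eqVneq x (6 * j + 5)) => [E|n2].
    have f2 : f (6 * j + 5) = 0 by rewrite -E; case: rx' => [h|->]; [lia|].
    by rewrite f2 g7; lia.
  case: (eqVneq x (6 * j + 7)) => [E|n4]; last by lia.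
  have f4 : f (6 * j + 7) = 0 by rewrite -E; case: rx' => [h|->]; [lia|].
  have := implyP h2; rewrite (_ : x %% 6 = 1); last lia.
  rewrite !inE => /(_ isT); rewrite fE; last lia.
  by rewrite (_ : x - 2 = 6 * j + 5); lia.
- apply/implyP => j1; move/implyP: A4 => /(_ j1) A4.
  case: (eqVneq x (6 * j - 1)) => [E|n1].
    have f2 : f (6 * j - 1) = 0 by rewrite -E; case: rx' => [h|->]; [lia|].
    clear -f2 E j1 g0 g6 g7; rewrite f2 g0 ?g6 ?g7; lia.
  case: (eqVneq x (6 * j)) => [E|n0].
    have x6 : 6 %| x by lia.
    have := gx 0 1; rewrite x6 subn0 E => /(_ isT).
    rewrite g6 ?g7; lia.
  case: (eqVneq x (6 * j + 6)) => [E|n6].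
    have x6 : 6 %| x by lia.
    have := gx 0 6; rewrite x6 subn0 E => /(_ isT).
    rewrite (_ : 6 * j + 6 - 6 = 6 * j) ?g7; try lia.
    have := f1 (6 * j - 1); lia.
  case: (eqVneq x (6 * j + 7)) => [E|n7]; last by lia.
  have f4 : f (6 * j + 7) = 0 by rewrite -E; case: rx' => [h|->]; [lia|].
  have := implyP h178; rewrite (_ : (x %% 6 == 1) = true); last first.
    by clear -E; lia.
  move=> /(_ isT); rewrite !fE; try by clear -E j1; lia.
  clear -E f4 j1 A4; subst x.
  rewrite (_ : 6 * j + 7 - 1 = 6 * j + 6); last by clear; lia.
  rewrite (_ : 6 * j + 7 - 7 = 6 * j); last by clear; lia.
  rewrite (_ : 6 * j + 7 - 8 = 6 * j - 1); last by clear; lia.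
  lia.
Qed.

Lemma admissibleE s : sorted geq s -> all (leq 1) s ->
  [&& repeat_cond s, gap_cond s & freq_cond s] = admissible s.
Proof.
elim: s => [//|x t IH] xt pos; have tt : sorted geq t by apply: path_sorted xt.
rewrite /= -IH //; last by case/andP: pos.
rewrite [LHS](_ : _ = [&& ((6 %| x) || (count_diffs x [:: 0] t <= 0)),
   count_diffs x (iota 0 (6 + (6 %| x))) t <= 1,
   [&& x %% 6 != 3,
      (x %% 6 \in [:: 1; 4]) ==> (count_diffs x [:: 2] t <= 0) &
      (x %% 6 == 1) ==> (count_diffs x [:: 1; 7; 8] t <= 2)] &
   [&& repeat_cond t, gap_cond t & freq_cond t]]).
  rewrite !andbA; congr (_ && _ && _ && _).
  rewrite /fits /dvdn; have := ltn_pmod x (isT : 0 < 6).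
  case: (x %% 6) => [|[|[|[|[|[|]]]]]] //= _;
    by rewrite ?andbT ?andbF // -?andbA; do 3?[case: (_ <= _)].
rewrite gap_cond_cons //.
case: (boolP (repeat_cond (x :: t))) => [rx|]; last first.
  by rewrite repeat_cond_cons negb_and => /orP[] /negbTE -> //=; rewrite !andbF.
case: (boolP (count_diffs x _ t <= 1)) => [gx|]; last by rewrite /= !andbF.
rewrite (freq_cond_cons xt pos rx gx).
move: rx; rewrite repeat_cond_cons => /andP[-> ->].
by case: gap_cond => /=; rewrite ?andbF //= !andbA.
Qed.

(** * Building a partition from blocks of six integers *)

(** The parts of the last two blocks, moved down to [1 .. 12]: parts further
    below cannot interact with the block [6 n + 1 .. 6 n + 6]. *)
Definition window (n : nat) (t : seq nat) : seq nat :=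
  [seq y + 12 - 6 * n | y <- t & 6 * n < y + 12].

Lemma count_diffs_window n x ds t : 0 < x -> all (leq^~ 8) ds ->
  count_diffs (x + 6 * n) ds t = count_diffs (x + 12) ds (window n t).
Proof.
move=> x1 /allP ds8; rewrite /count_diffs /window count_map count_filter.
apply: eq_count => y /=; apply/hasP/andP => [[d dds]|[/hasP[d dds]]] yd.
  have := ds8 _ dds => d8; split; last by lia.
  by apply/hasP; exists d => //; lia.
by move=> ?; exists d => //; lia.
Qed.

Lemma fits_window n x t : 0 < x ->
  fits (x + 6 * n) t = fits (x + 12) (window n t).
Proof.
move=> x1; rewrite /fits (_ : (x + 6 * n) %% 6 = (x + 12) %% 6); last by lia.
congr (_ && _); apply: eq_in_all => r rr; rewrite count_diffs_window //.
have /allP/(_ r rr) // :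
    all (fun r => all (leq^~ 8) r.1) (diff_bounds ((x + 12) %% 6)).
by case: (_ %% 6) => [|[|[|[|[|i]]]]].
Qed.

Fixpoint fits_block (e w : seq nat) : bool :=
  if e is x :: e'
  then fits (x + 12) (map (addn^~ 12) e' ++ w) && fits_block e' w
  else true.

Lemma admissible_block n e t : all (leq 1) e ->
  admissible (map (addn^~ (6 * n)) e ++ t) =
  fits_block e (window n t) && admissible t.
Proof.
elim: e => [|x e IH] //= /andP[x1 e1]; rewrite IH // fits_window // andbA.
congr (_ && _ && _); congr fits.
rewrite /window filter_cat map_cat; congr (_ ++ _).
rewrite (_ : filter _ _ = map (addn^~ (6 * n)) e).
  by rewrite -map_comp; apply: eq_map => y /=; lia.
by apply/all_filterP; rewrite all_map; apply: sub_all e1 => y /=; lia.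
Qed.

(** A block has at most two parts, since three of them would violate the
    condition on parts two places apart ([fits_block_small]). *)
Definition blocks : seq (seq nat) :=
  [::] :: [seq [:: x] | x <- iota 1 6] ++
          [seq [:: x; y] | x <- iota 1 6, y <- iota 1 6].

Definition next_blocks (w : seq nat) : seq (seq nat) :=
  [seq e <- blocks | sorted geq e && fits_block e w].

Lemma fits_block_small e w : sorted geq e -> all (fun x => 0 < x <= 6) e ->
  fits_block e w -> e \in blocks.
Proof.
rewrite /blocks; case: e => [//|x [|y [|z e]]].
- move=> _ /andP[x6 _] _; rewrite inE mem_cat map_f ?orbT //.
  by rewrite mem_iota; lia.
- move=> _ /and3P[x6 y6 _] _; rewrite inE mem_cat.
  by rewrite allpairs_f ?orbT // mem_iota; lia.
move=> /= /and3P[xy yz _] /and4P[x6 y6 z6 _] /andP[/andP[x3 /allP H] _].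
have two k : 6 <= k -> count_diffs (x + 12) (iota 0 k, 1).1
    (y + 12 :: z + 12 :: map (addn^~ 12) e ++ w) <= (iota 0 k, 1).2 = false.
  move=> k6; rewrite /count_diffs /=.
  have hy u : u <= x -> 0 < u -> has (fun d => u + 12 + d == x + 12) (iota 0 k).
    by move=> ux u1; apply/hasP; exists (x - u); rewrite ?mem_iota; lia.
  by rewrite !hy //; move: xy yz; rewrite /geq /=; lia.
exfalso; move: H; case: (_ %% 6) => [|i].
  by move/(_ (iota 0 7, 1) (mem_head _ _)); rewrite two.
move=> H; suff: (iota 0 6, 1) \in diff_bounds i.+1 by move/H; rewrite two.
by case: i {H} => [|[|[|[|i]]]].
Qed.

Fixpoint admissible_upto (n : nat) : seq (seq nat) :=
  if n is m.+1
  then [seq map (addn^~ (6 * m)) e ++ t |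
         t <- admissible_upto m, e <- next_blocks (window m t)]
  else [:: [::]].

Lemma sorted_split k s : sorted geq s ->
  s = [seq x <- s | k < x] ++ [seq x <- s | x <= k].
Proof.
elim: s => [//|x s IH] /= xs; have s' := path_sorted xs.
case: (leqP x k) => [xk|_]; last by rewrite /= -IH.
move: xs; rewrite (path_sortedE (rev_trans leq_trans)) => /andP[/allP xs _].
rewrite (_ : [seq x <- s | k < x] = [::]) /=.
  congr (_ :: _); apply/esym/all_filterP/allP => y /xs /=; lia.
apply/eqP; rewrite -[_ == _]negbK -has_filter -all_predC.
by apply/allP => y /xs /=; lia.
Qed.

Lemma blocks_range e : e \in blocks -> all (fun x => 0 < x <= 6) e.
Proof. by apply/allP: e; vm_compute. Qed.

Lemma filter_block n e t : all (fun x => 0 < x <= 6) e ->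
  all (fun x => 0 < x <= 6 * n) t ->
  let s := map (addn^~ (6 * n)) e ++ t in
  [seq x <- s | 6 * n < x] = map (addn^~ (6 * n)) e /\
  [seq x <- s | x <= 6 * n] = t.
Proof.
move=> e6 t6 s; rewrite !filter_cat !filter_map; split.
  rewrite (_ : filter _ t = [::]) ?cats0.
    by congr map; apply/all_filterP; apply: sub_all e6 => x /=; lia.
  apply/eqP; rewrite -[_ == _]negbK -has_filter -all_predC.
  by apply: sub_all t6 => x /=; lia.
rewrite (_ : filter _ e = [::]) /=.
  by apply/all_filterP; apply: sub_all t6 => x /=; lia.
apply/eqP; rewrite -[_ == _]negbK -has_filter -all_predC.
by apply: sub_all e6 => x /=; lia.
Qed.

Lemma mem_admissible_upto n s : (s \in admissible_upto n) =
  [&& sorted geq s, all (fun x => 0 < x <= 6 * n) s & admissible s].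
Proof.
have tr : transitive geq by apply: rev_trans leq_trans.
elim: n s => [|n IH] s.
  rewrite inE; apply/eqP/and3P => [->//|[_ ]].
  by case: s => //= x s; lia.
apply/allpairsPdep/and3P => [[t [e [tB]]]|[ss s6 gs]].
  move: tB; rewrite IH mem_filter => /and3P[st t6 gt] /andP[/andP[se fe] eb] ->.
  have e6 := blocks_range eb.
  split.
  - rewrite (sorted_pairwise tr) pairwise_cat -!(sorted_pairwise tr) st andbT.
    rewrite sorted_map (eq_sorted (e' := geq)) ?se ?andbT.
      apply/allrelP => _ y /mapP[x xe ->] yt /=.
      have := allP e6 _ xe; have := allP t6 _ yt; rewrite /geq /=; lia.
    by move=> x y; rewrite /relpre /geq /=; lia.
  - rewrite all_cat all_map; apply/andP; split.
      by apply: sub_all e6 => x /=; lia.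
    by apply: sub_all t6 => x; lia.
  - by rewrite admissible_block ?fe //; apply: sub_all e6 => x /=; lia.
pose e := [seq x - 6 * n | x <- s & 6 * n < x].
pose t := [seq x <- s | x <= 6 * n].
have e6 : all (fun x => 0 < x <= 6) e.
  apply/allP => _ /mapP[x + ->]; rewrite mem_filter => /andP[xn xs].
  by have := allP s6 _ xs; move=> /=; lia.
have t6 : all (fun x => 0 < x <= 6 * n) t.
  apply/allP => x; rewrite mem_filter => /andP[xn xs].
  by have := allP s6 _ xs; move=> /=; lia.
have sE : s = map (addn^~ (6 * n)) e ++ t.
  rewrite [LHS](sorted_split (6 * n) ss); congr (_ ++ _).
  rewrite /e -map_comp -[LHS]map_id; apply/eq_in_map => x.
  by rewrite mem_filter => /andP[xn _] /=; lia.
have e1 : all (leq 1) e by apply: sub_all e6 => x /andP[].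
move: gs; rewrite sE admissible_block // => /andP[fe gt].
exists t, e; split=> //; first by rewrite IH t6 gt !andbT; apply: sorted_filter.
have se : sorted geq e.
  have : sorted geq [seq x <- s | 6 * n < x] by apply: sorted_filter.
  rewrite /e sorted_map; apply: sub_sorted => x y; rewrite /relpre /geq /=; lia.
by rewrite mem_filter se fe (fits_block_small se e6 fe).
Qed.

Lemma admissible_upto_uniq n : uniq (admissible_upto n).
Proof.
elim: n => [//|n IH]; apply: allpairs_uniq_dep => //.
  by move=> t _; rewrite filter_uniq.
move=> _ _ /allpairsPdep[t [e [tB eB ->]]] /allpairsPdep[u [f [uB fB ->]]] /= E.
move: tB uB eB fB; rewrite !mem_admissible_upto !mem_filter.
move=> /and3P[_ t6 _] /and3P[_ u6 _].
move=> /andP[_ /blocks_range e6] /andP[_ /blocks_range f6].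
have [E1 E2] := filter_block e6 t6; have [E3 E4] := filter_block f6 u6.
move: E1 E2; rewrite E E3 E4 => E1 ->.
by rewrite (inj_map (@addIn (6 * n)) E1).
Qed.

(** * An automaton with nine states *)

Definition upper_block (w : seq nat) : seq nat := [seq y - 6 | y <- w & 6 < y].

Definition next_window (w e : seq nat) : seq nat :=
  map (addn^~ 6) e ++ upper_block w.

(** The parts [1] and [2] of a block do not restrict the next block, unless the
    block is [[:: 6; 2]]. *)
Definition relevant (e : seq nat) : seq nat :=
  if e == [:: 6; 2] then e else [seq x <- e | 3 < x].

(** A state is a representative block.  Only the window [[:: 12; 6; 5]] makes
    the last block but one matter: the condition on four frequencies forbids the
    part [13] after it, and so does [[:: 6; 2]] through the parts two places
    apart; the other continuations are the same as well. *)
Definition state_of (w : seq nat) : seq nat :=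
  if w == [:: 12; 6; 5] then [:: 6; 2] else relevant (upper_block w).

Definition moves (st : seq nat) : seq (seq nat * seq nat) :=
  [seq (e, state_of (next_window (map (addn^~ 6) st) e)) |
    e <- next_blocks (map (addn^~ 6) st)].

Definition windows : seq (seq nat) :=
  [seq next_window (map (addn^~ 6) d) e |
    d <- next_blocks [::], e <- next_blocks (map (addn^~ 6) d)].

Definition states : seq (seq nat) :=
  [:: [::]; [:: 4]; [:: 5]; [:: 6]; [:: 6; 2]; [:: 5; 4]; [:: 6; 4]; [:: 6; 5];
      [:: 6; 6]].

(** A finite verification: which blocks may follow a window, and the state
    reached by each of them, depend only on the state of the window. *)
Lemma windows_closed : all (fun w =>
  (state_of w \in states) &&
  ([seq (e, state_of (next_window w e)) | e <- next_blocks w]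
     == moves (state_of w)) &&
  all (fun e => next_window w e \in windows) (next_blocks w)) windows.
Proof. by vm_compute. Qed.

Lemma window_cat n e t :
  window n.+1 (map (addn^~ (6 * n)) e ++ t) = next_window (window n t) e.
Proof.
rewrite /window /next_window /upper_block filter_cat map_cat; congr (_ ++ _).
  rewrite (_ : filter _ _ = map (addn^~ (6 * n)) e).
    by rewrite -map_comp; apply: eq_map => y /=; lia.
  by apply/all_filterP; rewrite all_map; apply/allP => y _ /=; lia.
rewrite filter_map -filter_predI -map_comp.
rewrite (eq_filter (a2 := fun y => 6 * n.+1 < y + 12)); last first.
  by move=> y /=; lia.
by apply: eq_map => y /=; lia.
Qed.

Lemma mem_windows n t : t \in admissible_upto n -> window n t \in windows.
Proof.
elim: n t => [|n IH] t; first by rewrite inE => /eqP ->; vm_compute.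
case/allpairsPdep => [u [e [/IH uw eu ->]]]; rewrite window_cat.
by have /allP/(_ _ uw)/andP[_ /allP/(_ _ eu)] := windows_closed.
Qed.

(** * Enumerating polynomials and the linear recurrence *)

Section GeneratingFunctions.
Local Open Scope ring_scope.
Variables (R : comNzRingType) (a b q : R).

Definition weight (t : seq nat) : R :=
  a ^+ parts_mod6 [:: 0; 1; 2]%N t * b ^+ parts_mod6 [:: 0; 4; 5]%N t
  * q ^+ sumn t.

Lemma weight_cat s t : weight (s ++ t)%SEQ = weight s * weight t.
Proof. by rewrite /weight /parts_mod6 !count_cat sumn_cat !exprD; ring. Qed.

Lemma weight_shift n e :
  weight (map (addn^~ (6 * n)%N) e) = weight e * (q ^+ 6 ^+ n) ^+ size e.
Proof.
elim: e => [|x e IH]; first by rewrite /= mulr1.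
rewrite -cat1s map_cat !weight_cat IH [size _]/= (exprS _ (size e)).
suff -> : weight (map (addn^~ (6 * n)%N) [:: x]) =
    weight [:: x] * (q ^+ 6) ^+ n by ring.
rewrite /weight /parts_mod6 /= (_ : ((x + 6 * n) %% 6 = x %% 6)%N); last by lia.
by rewrite !addn0 exprD -exprM; ring.
Qed.

Definition gfB (n : nat) (f : seq nat -> R) : R :=
  \sum_(t <- admissible_upto n) weight t * f (state_of (window n t)).

Definition moves_sum (z : R) (st : seq nat) (f : seq nat -> R) : R :=
  \sum_(m <- moves st) weight m.1 * z ^+ size m.1 * f m.2.

Lemma gfB_linear n d1 d2 d3 d4 f1 f2 f3 f4 :
  gfB n (fun st => f1 st * d1 + f2 st * d2 + f3 st * d3 + f4 st * d4) =
  gfB n f1 * d1 + gfB n f2 * d2 + gfB n f3 * d3 + gfB n f4 * d4.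
Proof.
by rewrite /gfB !mulr_suml -!big_split; apply: eq_bigr => t _ /=; ring.
Qed.

Lemma gfB_recl n f :
  gfB n.+1 f = gfB n (fun st => moves_sum ((q ^+ 6) ^+ n) st f).
Proof.
rewrite /gfB big_allpairs_dep; apply: eq_big_seq => t /mem_windows tw.
have /allP/(_ _ tw)/andP[/andP[_ /eqP E] _] := windows_closed.
rewrite /moves_sum -E big_map mulr_sumr; apply: eq_bigr => e _ /=.
by rewrite window_cat weight_cat weight_shift; ring.
Qed.

Let a1 := a * q.
Let a2 := a * q ^+ 2.
Let b1 := b * q ^+ 4.
Let b2 := b * q ^+ 5.
Let c := a * b * q ^+ 6.

Definition column66 (f : seq nat -> R) := f [::].
Definition column65 z f :=
  f [::] + b2 * z * f [:: 5]%N + c * z * f [:: 6; 2]%N.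
Definition column64 z f :=
  f [::] + b1 * z * f [:: 4]%N + b2 * z * f [:: 5]%N + c * z * f [:: 6]%N.
Definition column54 z f :=
  column64 z f + z ^+ 2 * (b1 * b2 * f [:: 5; 4]%N + b1 * c * f [:: 6; 4]%N
                         + b2 * c * f [:: 6; 5]%N + c ^+ 2 * f [:: 6; 6]%N).

Definition coord54 (st : seq nat) : R :=
  if st \in [:: [::]; [:: 4]; [:: 5]; [:: 5; 4]]%N then 1 else 0.
Definition coord64 (z : R) (st : seq nat) : R :=
  if st \in [:: [:: 6; 4]; [:: 6; 2]; [:: 6]]%N then 1
  else if st \in [:: [::]; [:: 4]]%N then a1 * z else 0.
Definition coord65 (z : R) (st : seq nat) : R :=
  if st == [:: 6; 5]%N then 1
  else if st \in [:: [::]; [:: 4]; [:: 5]]%N then a2 * z else 0.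
Definition coord66 (z : R) (st : seq nat) : R :=
  if st == [:: 6; 6]%N then 1
  else if st == [:: 6; 2]%N then a2 * z
  else if st == [:: 6]%N then (a1 + a2) * z
  else if st == [::] then a1 * a2 * z ^+ 2 else 0.

(** The weighted sums over the moves from the four states [[:: 5; 4]],
    [[:: 6; 4]], [[:: 6; 5]], [[:: 6; 6]] span those from all nine states.  For
    example, the blocks that may follow [[:: 5]] but not [[:: 5; 4]] are
    [[:: 2]], [[:: 5; 2]], [[:: 6; 2]]: they are the blocks that may follow
    [[:: 6; 5]] with a part [2] added, and they lead to the same states. *)
Lemma moves_sum_columns z st f : st \in states ->
  moves_sum z st f = coord54 st * column54 z f + coord64 z st * column64 z f
                   + coord65 z st * column65 z f + coord66 z st * column66 f.
Proof.
rewrite /states !inE /moves_sum => H.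
repeat (case/orP: H => [/eqP ->|H] || (move/eqP: H => ->));
match goal with |- context [moves ?s] =>
  let v := eval vm_compute in (moves s) in
  rewrite (_ : moves s = v); last by vm_compute end;
rewrite !big_cons big_nil /weight /parts_mod6 /= /coord54 /coord64 /coord65;
rewrite /coord66 /column54 /column64 /column65 /column66 /=;
by rewrite /a1 /a2 /b1 /b2 /c; ring.
Qed.

Lemma gfB_moves n f :
  let z := q ^+ 6 ^+ n in
  gfB n.+1 f =
  gfB n coord54 * column54 z f + gfB n (coord64 z) * column64 z f +
  gfB n (coord65 z) * column65 z f + gfB n (coord66 z) * column66 f.
Proof.
rewrite /= gfB_recl -gfB_linear; apply: eq_big_seq => t /mem_windows tw.
have /allP/(_ _ tw)/andP[/andP[sw _] _] := windows_closed.
by rewrite moves_sum_columns.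
Qed.
End GeneratingFunctions.

Section Transfer.
Local Open Scope ring_scope.
Variables (R : comNzRingType) (s p c Q : R).

(** With the parameters of [gfB_transfer], and for the partitions with parts at
    most [6 * n]: [vu] enumerates those without the part [6 * n], [vx] those in
    which it occurs once, [c * vt] those in which it occurs twice; [vw] is what
    the recurrence needs besides. *)
Record coords := Coords { vu : R; vx : R; vt : R; vw : R }.

Definition step (z : R) (v : coords) : coords :=
  let: Coords u x t w := v in
  Coords ((1 + s * z) * (u + (1 - z) * x) + (p + c) * z ^+ 2 * u
            + (1 - z) * (c * t - w))
         (c * z * ((1 + s * z) * u + (1 - z) * x))
         (c * z ^+ 2 * u)
         (c * Q * z ^+ 2 * ((p + c) * z * u + (1 - z) * (c * t))).

Fixpoint transfer (n : nat) : coords :=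
  if n is m.+1 then step (Q ^+ m) (transfer m) else Coords 1 0 0 0.

Definition total (v : coords) := vu v + vx v + c * vt v.

Lemma transferS n : transfer n.+1 = step (Q ^+ n) (transfer n).
Proof. by []. Qed.
End Transfer.

Section Solve.
Local Open Scope ring_scope.
Variables (R : comNzRingType) (a b q : R).
Let a1 := a * q.
Let a2 := a * q ^+ 2.
Let b1 := b * q ^+ 4.
Let b2 := b * q ^+ 5.
Let c := a * b * q ^+ 6.
Let v n :=
  transfer (a1 + a2 + b1 + b2) ((a1 + b2) * (a2 + b1)) c (q ^+ 6) n.

(** The right-hand sides come from eliminating in the recurrence of
    [gfB_moves]; the relations [a1 * b2 = c] and [a2 * b1 = c] produce the
    factors [1 - z] and make [a1], [a2], [b1], [b2] enter the recurrence on
    [u], [x], [t], [w] only through the first two arguments of [transfer]. *)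
Lemma gfB_transfer n :
  let z := q ^+ 6 ^+ n in let: Coords u x t w := v n in
  [/\ gfB a b q n (coord54 R) = u,
      gfB a b q n (coord65 a q z) = a2 * z * u + (1 - z) * (b2 * t),
      gfB a b q n (coord64 a q z) = a1 * z * u + (1 - z) * (x - b2 * t) &
      gfB a b q n (coord66 a q z) = a1 * a2 * z ^+ 2 * u
        + (1 - z) * ((a1 + a2) * z * x + (c + b1 * b2 * z) * t - w)].
Proof.
elim: n => [|n IH].
  rewrite /= /gfB /= !big_cons !big_nil /coord54 /coord64 /coord65 /coord66.
  rewrite /weight /parts_mod6 /= expr0.
  by rewrite /a1 /a2 /b1 /b2 /c; split; ring.
rewrite /v transferS -/(v n).
move: IH => /=; case: (v n) => u x t w /= [E1 E2 E3 E4].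
rewrite !gfB_moves E1 E2 E3 E4 (exprS (q ^+ 6)) /coord54 /coord64 /coord65.
rewrite /coord66 /column54 /column64 /column65 /column66 /=.
rewrite /a1 /a2 /b1 /b2 /c; set z := _ ^+ n.
by split; ring.
Qed.

Lemma gfB_total n : gfB a b q n (fun=> 1) = total c (v n).
Proof.
case: n => [|n]; first by rewrite /gfB big_seq1 /weight /total /=; ring.
have := gfB_transfer n; rewrite /v transferS -/(v n).
case: (v n) => u x t w /= [E1 E2 E3 E4].
rewrite gfB_moves E1 E2 E3 E4 /column54 /column64 /column65 /column66 /total /=.
rewrite /a1 /a2 /b1 /b2 /c; set z := _ ^+ n.
by ring.
Qed.
End Solve.

(** * The shifted recurrence and the product *)

Section Shift.
Local Open Scope ring_scope.

(** The step with [z = 1] annihilates every coordinate except [vu], and [g] is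
    the total after that first step.  The [n] further steps turn out to be
    conjugate to [n] steps with the parameters [s Q], [p Q^2], [c Q^2]. *)
Lemma total_transfer_shift (R : comNzRingType) (s p c Q : R) n :
  let g := (1 + s + p + c) + c * (1 + s) + c ^+ 2 in
  g * vu (transfer (s * Q) (p * Q ^+ 2) (c * Q ^+ 2) Q n) =
  total c (transfer s p c Q n.+1).
Proof.
move=> g; pose T n := transfer s p c Q n.
pose h n := transfer (s * Q) (p * Q ^+ 2) (c * Q ^+ 2) Q n.
(* These two forms are rows of the intertwining map, found by requiring that
   they obey the recurrence of the shifted coordinates. *)
pose xi (z : R) v : R :=
  (c * z * vu v + (c - 1) * z * vx v - (1 + s) * z * (c * vt v) - vw v).
pose tau (z : R) v : R :=
  (c * Q * z * vx v + c * Q * vw v - c * vt v * Q * z * (1 + s + p + c)).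
(* The coordinate [vw] of [h n] is not followed: the last clause expresses it
   through the next total. *)
have : [/\ g * vu (h n) = total c (T n.+1),
    g * (1 - Q ^+ n) * vx (h n) = xi (Q ^+ n.+1) (T n.+1),
    g * (1 - Q ^+ n) * (c * Q ^+ 2 * vt (h n)) = tau (Q ^+ n.+1) (T n.+1) &
    g * vu (h n.+1) = total c (T n.+2)]; last by case.
elim: n => [|n].
  by rewrite /h /T /xi /tau /total /= !expr0 !expr1 /= /g; split; ring.
rewrite /h (transferS _ _ _ _ n.+1) (transferS _ _ _ _ n) -/(h n).
rewrite /T (transferS _ _ _ _ n.+2) (transferS _ _ _ _ n.+1) -/(T n.+1).
rewrite (exprS Q n.+1) (exprS Q n); set z := (Q ^+ n).
case: (T n.+1) => U X Y W; case: (h n) => u x t w.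
rewrite /xi /tau /total /= => -[E1 E2 E3 E4]; split.
- by rewrite E4.
- rewrite [LHS](_ : _ = (1 - Q * z) * (c * Q ^+ 2 * z) *
      ((1 + s * Q * z) * (g * u) + g * (1 - z) * x)); last by ring.
  by rewrite E1 E2; ring.
- rewrite [LHS](_ : _ = (1 - Q * z) *
      (c * Q ^+ 2 * (c * Q ^+ 2 * z ^+ 2 * (g * u)))); last by ring.
  by rewrite E1; ring.
set u' := (X in g * X = _) in E4.
rewrite [LHS](_ : _ =
    (1 + s * Q * (Q * z)) * (g * u' + (1 - Q * z) * (c * Q ^+ 2 * z)
        * ((1 + s * Q * z) * (g * u) + g * (1 - z) * x))
    + (p + c) * Q ^+ 2 * (Q * z) ^+ 2 * (g * u')
    + (1 - Q * z) * ((c * Q ^+ 2) ^+ 2 * z ^+ 2 * (g * u)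
        - c * Q ^+ 3 * z ^+ 2 * ((p + c) * Q ^+ 2 * z * (g * u)
            + g * (1 - z) * (c * Q ^+ 2 * t)))); last by rewrite /u'; ring.
by rewrite E4 E1 E2 E3; ring.
Qed.
End Shift.

Section Product.
Local Open Scope ring_scope.
Variables (R : comNzRingType) (e Q : R).

(* The relation between the weights is [a * (b * e) = (a * e) * b]. *)
Let v a b n :=
  transfer (a + a * e + b + b * e) ((a + b * e) * (a * e + b)) (a * b * e) Q n.
Let g a b := (1 + a) * (1 + a * e) * (1 + b) * (1 + b * e).

Definition qproduct a b n : R :=
  \prod_(i < n) ((1 + a * Q ^+ i) * (1 + a * e * Q ^+ i) *
                 (1 + b * Q ^+ i) * (1 + b * e * Q ^+ i)).

Lemma qproductS a b n :
  qproduct a b n.+1 = g a b * qproduct (a * Q) (b * Q) n.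
Proof.
rewrite /qproduct big_ord_recl /= expr0 !mulr1; congr (_ * _).
by apply: eq_bigr => i _; rewrite /bump /= add1n exprS; ring.
Qed.

Lemma total_shift a b n :
  total (a * b * e) (v a b n.+1) = g a b * vu (v (a * Q) (b * Q) n).
Proof.
rewrite /v -total_transfer_shift.
have -> : a * Q + a * Q * e + b * Q + b * Q * e =
  (a + a * e + b + b * e) * Q by ring.
have -> : (a * Q + b * Q * e) * (a * Q * e + b * Q) =
  (a + b * e) * (a * e + b) * Q ^+ 2 by ring.
have -> : a * Q * (b * Q) * e = a * b * e * Q ^+ 2 by ring.
by rewrite /g; ring.
Qed.

(** The factor [a * b * e] in the error term is what closes the induction: the
    shift multiplies it by [Q ^+ 2], which raises the exponent [n.-1]. *)
Lemma vu_product a b n : exists r,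
  vu (v a b n) = qproduct a b n + a * b * e * Q ^+ n.-1 * r.
Proof.
elim: n a b => [|n IH] a b.
  by exists 0; rewrite /qproduct big_ord0 /=; ring.
have [r E] := IH (a * Q) (b * Q); have := total_shift a b n.
rewrite E qproductS.
have [Q' ->] : exists Q',
    a * Q * (b * Q) * e * Q ^+ n.-1 = a * b * e * Q ^+ n * Q'.
  case: n {IH r E} => [|n]; first by exists (Q ^+ 2); rewrite /=; ring.
  by exists Q; rewrite exprS /=; ring.
rewrite {2}/v transferS -/(v a b n); set V := step _ _ _ _ _ _ => H.
have -> : vu V = total (a * b * e) V - vx V - a * b * e * vt V.
  by rewrite /total; ring.
rewrite {}H {}/V; case: (v a b n) => u x t w /=.
set z := Q ^+ n; set s := a + a * e + b + b * e.
exists (g a b * Q' * r - ((1 + s * z) * u + (1 - z) * x) - a * b * e * z * u).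
by ring.
Qed.

Lemma total_product a b n : exists r,
  total (a * b * e) (v a b n.+1) = qproduct a b n.+1 + Q ^+ n * r.
Proof.
rewrite total_shift qproductS; have [r ->] := vu_product (a * Q) (b * Q) n.
case: n => [|n].
  by exists (g a b * (a * Q * (b * Q) * e * r)); rewrite /= expr0; ring.
by exists (g a b * (a * b * e * Q * r)); rewrite exprS /=; ring.
Qed.
End Product.

(** * Partitions into distinct parts that are not multiples of three *)

Fixpoint distinct_upto (n : nat) : seq (seq nat) :=
  if n is m.+1
  then if 3 %| m.+1 then distinct_upto m
       else distinct_upto m ++ map (cons m.+1) (distinct_upto m)
  else [:: [::]].

Lemma mem_distinct_upto n s : (s \in distinct_upto n) =
  [&& sorted gtn s, all (fun x => 0 < x <= n) s & all (fun x => ~~ (3 %| x)) s].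
Proof.
have tr : transitive gtn by move=> x y z /= h1 h2; apply: ltn_trans h2 h1.
elim: n s => [|n IH] s.
  rewrite inE; apply/eqP/and3P => [->//|[_ ]].
  by case: s => //= x s; lia.
have cons_mem t :
    (n.+1 :: t \in map (cons n.+1) (distinct_upto n)) = (t \in distinct_upto n).
  by rewrite mem_map // => x y [].
have memE : (s \in distinct_upto n.+1) =
    (s \in distinct_upto n) ||
    (~~ (3 %| n.+1)) && (s \in map (cons n.+1) (distinct_upto n)).
  by rewrite /=; case: (3 %| n.+1); rewrite ?orbF ?mem_cat.
rewrite memE; apply/orP/and3P => [[|/andP[n3 /mapP[t]]]|[ss s6 s3]].
- by rewrite IH => /and3P[? h ?]; split=> //; apply: sub_all h => x /=; lia.
- rewrite IH => /and3P[st tn t3] ->; split=> /=; last by rewrite n3.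
    rewrite (path_sortedE tr) st andbT; apply: sub_all tn => x /=; lia.
  by apply/andP; split; [lia|apply: sub_all tn => x /=; lia].
case: s ss s6 s3 {memE} => [|x s] ss s6 s3; first by left; rewrite IH.
move: ss s6 s3 => /=; rewrite (path_sortedE tr).
move=> /andP[sx ss] /andP[xn sn] /andP[x3 s3].
have sxn : all (fun y => 0 < y <= x.-1) s.
  by apply/allP => y ys; have := allP sx _ ys; have := allP sn _ ys => /=; lia.
have [E|xn'] := eqVneq x n.+1.
  right; rewrite -E x3 /=; rewrite E cons_mem IH ss s3 andbT /=.
  by move: sxn; rewrite E.
left; rewrite IH /= (path_sortedE tr) sx ss x3 s3 /= !andbT.
apply/andP; split; first by lia.
by apply: sub_all sxn => y; lia.
Qed.

Lemma distinct_upto_uniq n : uniq (distinct_upto n).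
Proof.
elim: n => [//|n IH] /=; case: ifP => // _.
rewrite cat_uniq IH map_inj_uniq ?IH ?andbT; last by move=> x y [].
apply/hasPn => _ /mapP[t _ ->]; rewrite mem_distinct_upto /=.
by rewrite ltnn andbF.
Qed.

Section DistinctParts.
Local Open Scope ring_scope.
Variables (R : comNzRingType) (a b q : R).

Definition gfA n := \sum_(t <- distinct_upto n) weight a b q t.

Lemma gfAS n :
  gfA n.+1 = (if (3 %| n.+1)%N then 1 else 1 + weight a b q [:: n.+1]) * gfA n.
Proof.
rewrite /gfA /=; case: ifP => _; first by rewrite mul1r.
rewrite big_cat big_map mulrDl mul1r mulr_sumr; congr (_ + _).
by apply: eq_bigr => t _; rewrite -cat1s weight_cat.
Qed.

Lemma gfA_product n : gfA (6 * n) = qproduct q (q ^+ 6) (a * q) (b * q ^+ 4) n.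
Proof.
elim: n => [|n IH].
  by rewrite /gfA /qproduct big_ord0 big_seq1 /weight /=; ring.
rewrite /qproduct big_ord_recr -/(qproduct _ _ _ _ _) /= -IH.
rewrite mulnS addnC !addnS addn0 !gfAS.
rewrite (_ : (3 %| (6 * n).+1)%N = false); last by lia.
rewrite (_ : (3 %| (6 * n).+2)%N = false); last by lia.
rewrite (_ : (3 %| (6 * n).+3)%N = true); last by lia.
rewrite (_ : (3 %| (6 * n).+4)%N = false); last by lia.
rewrite (_ : (3 %| (6 * n).+4.+1)%N = false); last by lia.
rewrite (_ : (3 %| (6 * n).+4.+2)%N = true); last by lia.
have W r k : k = (6 * n + r)%N ->
    weight a b q [:: k] = weight a b q [:: r] * (q ^+ 6) ^+ n.
  by move=> ->; rewrite addnC -(weight_shift _ _ _ _ [:: r]).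
rewrite (W 1%N (6 * n).+1) ?(W 2%N (6 * n).+2) ?(W 4%N (6 * n).+4)
  ?(W 5%N (6 * n).+4.+1); try by lia.
by rewrite /weight /parts_mod6 /= !addn0; ring.
Qed.
End DistinctParts.

(** * Comparing coefficients *)

Section Coefficients.
Local Open Scope ring_scope.

Let ring_abq : comNzRingType := {poly {poly {poly int}}}.
Let va : ring_abq := 'X%:P.
Let vb : ring_abq := 'X%:P%:P.
Let vq : ring_abq := 'X.

Lemma coef_weight l mu nu N :
  (\sum_(t <- l) weight va vb vq t)`_N`_mu`_nu =
  (count (fun t => [&& sumn t == N, parts_mod6 [:: 0; 1; 2]%N t == mu &
                       parts_mod6 [:: 0; 4; 5]%N t == nu]) l)%:R.
Proof.
rewrite !coef_sum -sum1_count [in RHS]big_mkcond natr_sum.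
apply: eq_bigr => t _.
rewrite /weight /va /vb /vq -!rmorphXn -rmorphM /= coefCM coefXn eq_sym.
case: eqP => _; last by rewrite mulr0 !coef0.
rewrite mulr1 coefMC coefXn eq_sym; case: eqP => _; last by rewrite mul0r coef0.
by rewrite mul1r coefXn eq_sym; case: eqP.
Qed.

Lemma count_distinct_admissible n mu nu N : (N < 6 * n)%N ->
  let P t := [&& sumn t == N, parts_mod6 [:: 0; 1; 2]%N t == mu &
                 parts_mod6 [:: 0; 4; 5]%N t == nu] in
  count P (distinct_upto (6 * n.+1)) = count P (admissible_upto n.+1).
Proof.
move=> Nn P; apply/eqP; rewrite -eqz_nat -!natz -!coef_weight.
rewrite -/(gfA va vb vq _).
have -> : \sum_(t <- admissible_upto n.+1) weight va vb vq t =
    gfB va vb vq n.+1 (fun=> 1).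
  by apply: eq_bigr => t _; rewrite mulr1.
rewrite gfB_total gfA_product.
have [r] := total_product vq (vq ^+ 6) (va * vq) (vb * vq ^+ 4) n.
have -> : va * vq * (vb * vq ^+ 4) * vq = va * vb * vq ^+ 6 by ring.
have -> : va * vq * vq = va * vq ^+ 2 by ring.
have -> : vb * vq ^+ 4 * vq = vb * vq ^+ 5 by ring.
by move=> ->; rewrite coefD -exprM /vq coefXnM Nn addr0.
Qed.
End Coefficients.

Theorem theorem4 (mu nu N : nat) : A mu nu N = B mu nu N.
Proof.
pose P t := [&& sumn t == N, parts_mod6 [:: 0; 1; 2] t == mu &
                parts_mod6 [:: 0; 4; 5] t == nu].
have le_sum s m : sumn s == N -> N <= m -> all (leq 1) s ->
    all (fun x => 0 < x <= m) s.
  move=> /eqP sN Nm /allP s1; apply/allP => x xs; rewrite s1 //=.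
  by apply: leq_trans Nm; rewrite -sN mem_leq_sumn.
have N6 : N <= 6 * N.+2 by lia.
have pos1 s m : all (fun x => 0 < x <= m) s -> all (leq 1) s.
  by apply: sub_all => x /andP[].
have -> : A mu nu N = count P (distinct_upto (6 * N.+2)).
  rewrite -size_filter; apply: num_partitionsP.
    by rewrite filter_uniq // distinct_upto_uniq.
  move=> s; rewrite mem_filter mem_distinct_upto gtn_sorted_uniq_geq.
  rewrite /P /is_partition.
  have [s3|] := boolP (all (fun x => ~~ (3 %| x)) s); last by rewrite !andbF.
  have -> : parts_mod6 [:: 0; 1; 2] s = parts_mod6 [:: 1; 2] s.
    by apply: eq_in_count => x /(allP s3); rewrite !inE; lia.
  have -> : parts_mod6 [:: 0; 4; 5] s = parts_mod6 [:: 4; 5] s.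
    by apply: eq_in_count => x /(allP s3); rewrite !inE; lia.
  apply/idP/idP.
    by move=> /andP[/and3P[-> -> ->]] /and3P[/andP[-> ->] /pos1 -> _].
  case/andP => /and3P[-> h1 h2] /and4P[-> _ -> ->].
  by rewrite h2 (le_sum _ _ h2 N6 h1).
have -> : B mu nu N = count P (admissible_upto N.+2).
  rewrite -size_filter; apply: num_partitionsP.
    by rewrite filter_uniq // admissible_upto_uniq.
  move=> s; rewrite mem_filter mem_admissible_upto /P /is_partition.
  apply/idP/idP.
    case/andP => /and3P[-> -> ->] /and3P[ss /pos1 h1 gs].
    by have := admissibleE ss h1; rewrite gs ss h1 => /and3P[-> -> ->].
  case/andP => /and3P[ss h1 h2] /and5P[h3 h4 h5 -> ->].
  rewrite h2 ss (le_sum _ _ h2 N6 h1) /= -admissibleE //.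
  by rewrite h3 h4 h5.
by apply: count_distinct_admissible; lia.
Qed.
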